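(* For all integers $k,N\ge 0$ and all $x\in\mathbb{R}$, \[ p_{k+N}(x)=\sum_{i=0}^{\left[\frac{N+1}{2}\right]}\sum_{l=0}^{k}\binom{k}{l}(N-2i)_{l}\,2^{l}\,a_{i}(N)\,\langle x\rangle_{N-i}\,p_{k-l}(x+N-i), \] where $a_{0}(N)=1$ for all $N\ge0$; $a_{\frac{N+1}{2}}(N)=0$ whenever $N$ is an odd positive integer; and for $1\le i\le\left[\frac{N}{2}\right]$, \[ a_{i}(N)=2^{i}\sum_{k_{i}=1}^{N-2i+1}\sum_{k_{i-1}=1}^{k_{i}+1}\cdots\sum_{k_{1}=1}^{k_{2}+1}\left(\prod_{l=1}^{i}k_{l}\right). \]
   Context: For $x\in\mathbb{R}$, the convolved Fibonacci numbers $p_n(x)$, $n\ge 0$, are defined by \[ \left(\frac{1}{1-t-t^{2}}\right)^{x}=\sum_{n=0}^{\infty}p_{n}(x)\frac{t^{n}}{n!}. \] $[y]$ denotes the greatest integer not exceeding $y$. The falling factorial is $(y)_n=y(y-1)\cdots(y-n+1)$ for $n\ge1$, $(y)_0=1$; the rising factorial is $\langle x\rangle_n=x(x+1)\cdots(x+n-1)$ for $n\ge1$, $\langle x\rangle_0=1$. In the nested sum defining $a_i(N)$, the outermost index $k_i$ runs from $1$ to $N-2i+1$ and each inner index $k_{j-1}$ runs from $1$ to $k_j+1$. *)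

(* Defs.v *)
From Stdlib Require Import Reals List Arith.
From Coquelicot Require Import Coquelicot.
Import ListNotations.
Open Scope R_scope.

(* Near t = 0 one has 1 - t - t^2 > 0, so Rpower is the genuine real power. *)
Definition convolved_fibonacci (p : nat -> R -> R) : Prop :=
  forall x : R,
    locally (0 : R) (fun t : R =>
      is_series (fun n : nat => p n x * (t ^ n / INR (fact n)))
                (Rpower (1 / (1 - t - t ^ 2)) x)).

Fixpoint falling (y : R) (n : nat) : R :=
  match n with
  | O => 1
  | S m => falling y m * (y - INR m)
  end.

Fixpoint rising (x : R) (n : nat) : R :=
  match n with
  | O => 1
  | S m => rising x m * (x + INR m)
  end.

(* nested_sum i m f is the sum of f [k_i; ...; k_1] over 1 <= k_i <= m and
   1 <= k_(j-1) <= k_j + 1 for 2 <= j <= i. *)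
Fixpoint nested_sum (i m : nat) (f : list nat -> R) : R :=
  match i with
  | O => f []
  | S j => sum_n_m (fun k => nested_sum j (k + 1) (fun ks => f (k :: ks))) 1 m
  end.

Definition prod_of_list (ks : list nat) : R :=
  fold_right (fun k acc => INR k * acc) 1 ks.

(* For i <= (N + 1) / 2 the last branch is reached only when N is odd and
   i = (N + 1) / 2. In the middle branch 2 * i <= N, so N - 2 * i is exact. *)
Definition coef_a (i N : nat) : R :=
  if (i =? 0)%nat then 1
  else if (i <=? N / 2)%nat
       then 2 ^ i * nested_sum i (N - 2 * i + 1) prod_of_list
       else 0.

(* Main.v *)
(* The equation f_x' = x (1 + 2 t) f_(x+1) for f_x = (1 - t - t^2)^(-x), read on
   Taylor coefficients, is p_(n+1)(x) = x (p_n(x+1) + 2 n p_(n-1)(x+1)). By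
   induction on N it gives f_x^(N) = sum_i a_i(N) <x>_(N-i) (1 + 2 t)^(N-2i)
   f_(x+N-i), where a_i(N+1) = a_i(N) + 2 (N - 2i + 2) a_(i-1)(N) is the
   recurrence satisfied by the nested sums; the k-th derivative at 0, expanded by
   Leibniz' rule, is the theorem. *)

Require Import Defs.
From Stdlib Require Import Reals Arith List Lia Lra.
From Coquelicot Require Import Coquelicot.
Open Scope R_scope.

(** * Recurrence for the coefficients a_i(N) *)

Lemma sum_n_m_Sn (f : nat -> R) (m : nat) :
  sum_n_m f 1 (S m) = sum_n_m f 1 m + f (S m).
Proof. rewrite sum_n_Sm; [reflexivity | lia]. Qed.

Lemma nested_sum_scal (i : nat) (c : R) : forall (m : nat) (f : list nat -> R),
  nested_sum i m (fun ks => c * f ks) = c * nested_sum i m f.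
Proof.
  induction i as [|i IH]; intros m f; simpl; [reflexivity|].
  rewrite <- (sum_n_m_mult_l (K := R_Ring) c).
  apply sum_n_m_ext; intros j.
  exact (IH (j + 1)%nat (fun ks => f (j :: ks))).
Qed.

(** Split off the last value m + 1 of the outermost index: it factors out of the product and leaves
    the inner sums with bound m + 2. *)
Lemma nested_sum_prod_step (i m : nat) :
  nested_sum (S i) (S m) prod_of_list =
  nested_sum (S i) m prod_of_list
    + INR (S m) * nested_sum i (S m + 1) prod_of_list.
Proof.
  rewrite <- nested_sum_scal.
  exact (sum_n_m_Sn _ m).
Qed.

(** For 2i < N this is [nested_sum_prod_step] with m = N - 2i - 1, where m + 1 = N - 2i is the extra
    factor; otherwise every term vanishes. *)
Lemma coef_a_succ (i N : nat) :
  coef_a (S i) (S N) = coef_a (S i) N + 2 * (INR N - 2 * INR i) * coef_a i N.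
Proof.
  assert (HN : (2 * (N / 2) <= N < 2 * (N / 2) + 2)%nat).
  { pose proof (Nat.div_mod_eq N 2); pose proof (Nat.mod_upper_bound N 2); lia. }
  assert (HS : (2 * (S N / 2) <= S N < 2 * (S N / 2) + 2)%nat).
  { pose proof (Nat.div_mod_eq (S N) 2); pose proof (Nat.mod_upper_bound (S N) 2); lia. }
  assert (Ha : (2 * i <= N)%nat ->
    coef_a i N = 2 ^ i * nested_sum i (N - 2 * i + 1) prod_of_list).
  { intros H; unfold coef_a.
    destruct (Nat.eqb_spec i 0) as [-> | ].
    - simpl; lra.
    - destruct (Nat.leb_spec i (N / 2)); [reflexivity | lia]. }
  destruct (Nat.lt_ge_cases (2 * i) N) as [H | H].
  - rewrite Ha by lia.
    replace (coef_a (S i) (S N)) with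
      (2 ^ S i * nested_sum (S i) (S (N - 2 * i - 1)) prod_of_list).
    2:{ unfold coef_a; simpl Nat.eqb.
        destruct (Nat.leb_spec (S i) (S N / 2)); [|lia].
        do 2 f_equal; lia. }
    replace (coef_a (S i) N) with
      (2 ^ S i * nested_sum (S i) (N - 2 * i - 1) prod_of_list).
    2:{ unfold coef_a; simpl Nat.eqb.
        destruct (Nat.leb_spec (S i) (N / 2)).
        - do 2 f_equal; lia.
        (* Here N = 2i + 1: the zero branch of [coef_a] agrees with an empty nested sum. *)
        - replace (N - 2 * i - 1)%nat with 0%nat by lia.
          simpl nested_sum; rewrite sum_n_m_zero by lia.
          apply Rmult_0_r. }
    rewrite nested_sum_prod_step.
    replace (S (N - 2 * i - 1)) with (N - 2 * i)%nat by lia.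
    rewrite minus_INR, mult_INR by lia; simpl (INR 2); simpl (2 ^ S i); ring.
  - assert (Hz : forall M, (M <= S N)%nat -> coef_a (S i) M = 0).
    { intros M HM; unfold coef_a; simpl Nat.eqb.
      pose proof (Nat.div_mod_eq M 2).
      destruct (Nat.leb_spec (S i) (M / 2)); [lia | reflexivity]. }
    rewrite !Hz by lia.
    (* For N = 2i the factor N - 2i is 0; for N < 2i the coefficient a_i(N) is. *)
    destruct (Nat.eq_dec (2 * i) N) as [<- | ].
    + rewrite mult_INR; simpl (INR 2); ring.
    + unfold coef_a.
      destruct (Nat.eqb_spec i 0); [lia|].
      destruct (Nat.leb_spec i (N / 2)); [lia | ring].
Qed.

Lemma coef_a_0 (N : nat) : coef_a 0 N = 1.
Proof. reflexivity. Qed.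

Lemma coef_a_eq_0 (i N : nat) : (0 < i)%nat -> (N < 2 * i)%nat -> coef_a i N = 0.
Proof.
  intros Hi H; unfold coef_a.
  pose proof (Nat.div_mod_eq N 2).
  destruct (Nat.eqb_spec i 0); [lia|].
  destruct (Nat.leb_spec i (N / 2)); [lia | reflexivity].
Qed.

(** * Falling factorials, binomial sums and Leibniz' rule *)

Lemma falling_succ_l (M : R) (l : nat) : falling M (S l) = M * falling (M - 1) l.
Proof.
  induction l as [|l IH]; [simpl; ring|].
  change (falling M (S l) * (M - INR (S l))
          = M * (falling (M - 1) l * (M - 1 - INR l))).
  rewrite IH, S_INR; ring.
Qed.

(** On Taylor coefficients this is (1 + 2t)^(M+1) = (1 + 2t)^M + 2t (1 + 2t)^M. At l = 0 the value
    of [pred] is killed by the factor [INR 0]. *)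
Lemma falling_add_1 (M : R) (l : nat) :
  falling (M + 1) l = falling M l + INR l * falling M (pred l).
Proof.
  destruct l as [|l]; [simpl; ring|].
  rewrite falling_succ_l; replace (M + 1 - 1) with M by ring.
  rewrite S_INR; simpl; ring.
Qed.

(** Pascal's rule, in the form that takes Leibniz' rule from order k to k + 1. *)
Lemma sum_C_succ (g : nat -> R) (k : nat) :
  sum_f_R0 (fun l => Binomial.C (S k) l * g l) (S k) =
  sum_f_R0 (fun l => Binomial.C k l * (g l + g (S l))) k.
Proof.
  rewrite decomp_sum by lia; simpl pred.
  rewrite C_n_0.
  destruct k as [|k].
  - simpl sum_f_R0; rewrite C_n_0, C_n_n; ring.
  - rewrite tech5, C_n_n.
    rewrite (sum_eq _ (fun l => Binomial.C (S k) l * g (S l)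
                                + Binomial.C (S k) (S l) * g (S l)) k).
    2:{ intros i Hi; rewrite <- pascal by lia; ring. }
    rewrite plus_sum.
    rewrite (sum_eq (fun l => Binomial.C (S k) l * (g l + g (S l)))
      (fun l => Binomial.C (S k) l * g l + Binomial.C (S k) l * g (S l)) (S k))
      by (intros; ring).
    rewrite plus_sum.
    rewrite (decomp_sum (fun l => Binomial.C (S k) l * g l)) by lia.
    simpl pred.
    rewrite (tech5 (fun l => Binomial.C (S k) l * g (S l))), C_n_0, C_n_n; ring.
Qed.

(** Shift l by one in (k - l) C(k,l) = (l + 1) C(k,l+1); the two unmatched end terms carry a zero
    factor. *)
Lemma sum_C_absorb (g : nat -> R) (k : nat) :
  sum_f_R0 (fun l => Binomial.C k l * INR (k - l) * g l) k =
  sum_f_R0 (fun l => Binomial.C k l * INR l * g (pred l)) k.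
Proof.
  destruct k as [|k]; [simpl; ring|].
  rewrite tech5, Nat.sub_diag.
  rewrite (decomp_sum (fun l => Binomial.C (S k) l * INR l * _)) by lia.
  simpl (INR 0); simpl (pred (S k)).
  rewrite !Rmult_0_r, !Rmult_0_l, Rplus_0_l, Rplus_0_r.
  apply sum_eq; intros l Hl.
  rewrite pascal_step3 by lia.
  change (pred (S l)) with l; field; apply not_0_INR; lia.
Qed.

(* The [k]-th derivative at [0] of [(1 + 2 t)^M * (1 - t - t^2)^(-y)]. *)
Definition leibniz_sum (p : nat -> R -> R) (M y : R) (k : nat) : R :=
  sum_f_R0 (fun l => Binomial.C k l * falling M l * 2 ^ l * p (k - l)%nat y) k.

Lemma leibniz_sum_0 (p : nat -> R -> R) (y : R) (k : nat) :
  leibniz_sum p 0 y k = p k y.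
Proof.
  unfold leibniz_sum.
  destruct k as [|k]; [simpl; rewrite C_n_0; ring|].
  rewrite decomp_sum by lia.
  rewrite sum_eq_R0.
  - rewrite C_n_0, Nat.sub_0_r; simpl; ring.
  - intros l _; rewrite falling_succ_l; ring.
Qed.

(** The k-th derivative at 0 of the product rule ((1 + 2t)^M f_y)' = 2M (1 + 2t)^(M-1) f_y + y (1 +
    2t)^(M+1) f_(y+1). *)
Lemma leibniz_sum_succ (p : nat -> R -> R)
    (hrec : forall n y,
      p (S n) y = y * (p n (y + 1) + 2 * INR n * p (pred n) (y + 1)))
    (M y : R) (k : nat) :
  leibniz_sum p M y (S k) =
  2 * M * leibniz_sum p (M - 1) y k + y * leibniz_sum p (M + 1) (y + 1) k.
Proof.
  unfold leibniz_sum.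
  rewrite (sum_eq _ (fun l => Binomial.C (S k) l
    * (falling M l * 2 ^ l * p (S k - l)%nat y))) by (intros; ring).
  rewrite sum_C_succ.
  rewrite !scal_sum.
  (* The term 2n p_(n-1) of [hrec] with n = k - l: absorption trades the factor k - l for l,
     matching the second term of [falling_add_1]. *)
  pose proof (sum_C_absorb (fun l => falling M l * 2 ^ S l
    * p (pred (k - l)) (y + 1) * y) k) as Habs.
  rewrite (sum_eq (fun l => Binomial.C k l * INR l * _)
    (fun l => Binomial.C k l * INR l * falling M (pred l) * 2 ^ l
      * p (k - l)%nat (y + 1) * y)) in Habs.
  2:{ intros [|l] Hl; [simpl; ring|].
      replace (pred (k - pred (S l))) with (k - S l)%nat by (simpl; lia).
      simpl pred; ring. }
  rewrite (sum_eq (fun l => _ * falling (M + 1) l * _ * _ * _)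
    (fun l => Binomial.C k l * falling M l * 2 ^ l * p (k - l)%nat (y + 1) * y
      + Binomial.C k l * INR l * falling M (pred l) * 2 ^ l
        * p (k - l)%nat (y + 1) * y))
    by (intros; rewrite falling_add_1; ring).
  rewrite plus_sum, <- Habs, <- !plus_sum.
  apply sum_eq; intros l Hl.
  replace (S k - l)%nat with (S (k - l)) by lia.
  replace (S k - S l)%nat with (k - l)%nat by lia.
  rewrite hrec, falling_succ_l; simpl pow; ring.
Qed.

(** * Expansion of p_(k+N) by induction on N *)

Lemma sum_f_R0_extend (f : nat -> R) (m n : nat) :
  (m <= n)%nat -> (forall i, (m < i <= n)%nat -> f i = 0) ->
  sum_f_R0 f n = sum_f_R0 f m.
Proof.
  induction 1 as [|n H IH]; intros Hf; [reflexivity|].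
  rewrite tech5, IH, Hf by (intros; try apply Hf; lia); ring.
Qed.

(** Summing up to N instead of [(N+1)/2] adds only zero terms and spares the induction a parity
    split. The exponent N - 2i is real, so it may be negative. *)
Lemma shift_expansion (p : nat -> R -> R)
    (hrec : forall n y,
      p (S n) y = y * (p n (y + 1) + 2 * INR n * p (pred n) (y + 1)))
    (N : nat) (x : R) : forall k : nat,
  p (k + N)%nat x =
  sum_f_R0 (fun i => coef_a i N * rising x (N - i)
    * leibniz_sum p (INR N - 2 * INR i) (x + INR (N - i)) k) N.
Proof.
  induction N as [|N IH]; intros k.
  - simpl sum_f_R0.
    rewrite coef_a_0, Nat.add_0_r; simpl.
    replace (0 - 2 * 0) with 0 by ring.
    rewrite leibniz_sum_0, Rplus_0_r; ring.
  - replace (k + S N)%nat with (S k + N)%nat by lia.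
    rewrite IH.
    (* [T i] is the i-th term at level N + 1 without its coefficient. Differentiating the i-th term
       at level N gives multiples of [T i] and [T (S i)], the factor y extending the rising
       factorial. *)
    pose (T := fun i => rising x (S N - i)
      * leibniz_sum p (INR (S N) - 2 * INR i) (x + INR (S N - i)) k).
    rewrite (sum_eq _ (fun i => coef_a i N * T i
      + 2 * (INR N - 2 * INR i) * coef_a i N * T (S i)) N).
    2:{ intros i Hi; unfold T.
        rewrite leibniz_sum_succ by exact hrec.
        replace (S N - S i)%nat with (N - i)%nat by lia.
        replace (S N - i)%nat with (S (N - i)) by lia.
        replace (INR (S N) - 2 * INR (S i)) with (INR N - 2 * INR i - 1)
          by (rewrite !S_INR; ring).
        replace (INR (S N) - 2 * INR i) with (INR N - 2 * INR i + 1)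
          by (rewrite !S_INR; ring).
        replace (x + INR (S (N - i))) with (x + INR (N - i) + 1)
          by (rewrite !S_INR; ring).
        simpl rising; ring. }
    rewrite plus_sum.
    rewrite (sum_eq (fun i => coef_a i (S N) * rising x (S N - i) * _)
      (fun i => coef_a i (S N) * T i)) by (intros; unfold T; ring).
    rewrite (decomp_sum (fun i => coef_a i (S N) * T i)) by lia; simpl pred.
    rewrite (sum_eq (fun i => coef_a (S i) (S N) * T (S i))
      (fun i => coef_a (S i) N * T (S i)
        + 2 * (INR N - 2 * INR i) * coef_a i N * T (S i)))
      by (intros; rewrite coef_a_succ; ring).
    rewrite plus_sum, <- Rplus_assoc.
    f_equal.
    (* Since a_(N+1)(N) = 0, the sum may run to N + 1 before its index is shifted. *)
    pose proof (decomp_sum (fun i => coef_a i N * T i) (S N)) as Hd.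
    rewrite tech5, (coef_a_eq_0 (S N)), !coef_a_0 in Hd by lia.
    simpl pred in Hd; rewrite coef_a_0, <- Hd by lia; ring.
Qed.

(** * From the generating function to the recurrence for p *)

Lemma locally_pseries_CV_radius (a : nat -> R) (f : R -> R) :
  locally (0 : R) (fun t : R => is_pseries a t (f t)) ->
  Rbar_lt 0 (CV_radius a).
Proof.
  intros [e He].
  assert (Hp : 0 < e / 2) by (pose proof (cond_pos e); lra).
  assert (Hs : is_pseries a (e / 2) (f (e / 2))).
  { apply He; change (Rabs (e / 2 - 0) < e).
    rewrite Rabs_pos_eq; lra. }
  (* The series converges at e/2, so its terms tend to 0 there, which fails outside the disk of
     convergence. *)
  apply Rbar_lt_le_trans with (Finite (Rabs (e / 2))).
  - simpl; rewrite Rabs_pos_eq; lra.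
  - apply Rbar_not_lt_le; intros Hlt.
    apply (CV_disk_outside _ _ Hlt), ex_series_lim_0.
    exists (f (e / 2)); apply is_pseries_R; exact Hs.
Qed.

Lemma is_derive_fib_power (x t : R) : 0 < 1 - t - t ^ 2 ->
  is_derive (fun t : R => Rpower (1 / (1 - t - t ^ 2)) x) t
    (x * ((1 + 2 * t) * Rpower (1 / (1 - t - t ^ 2)) (x + 1))).
Proof.
  intros H.
  assert (Hi : 0 < 1 / (1 - t - t ^ 2)) by (apply Rdiv_lt_0_compat; lra).
  rewrite Rpower_plus, Rpower_1 by exact Hi.
  unfold Rpower; auto_derive.
  - split; [lra | split; [|exact I]].
    exact Hi.
  - replace (1 * / (1 + - t + - (t * (t * 1)))) with (1 / (1 - t - t ^ 2))
      by (field; lra).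
    field; lra.
Qed.

(* Coefficient form of d/dt (1 - t - t^2)^(-x) = x (1 + 2 t) (1 - t - t^2)^(-x-1). *)
Lemma convolved_fibonacci_succ (p : nat -> R -> R) :
  convolved_fibonacci p -> forall n x,
  p (S n) x = x * (p n (x + 1) + 2 * INR n * p (pred n) (x + 1)).
Proof.
  intros hp n x.
  set (f := fun (x t : R) => Rpower (1 / (1 - t - t ^ 2)) x).
  set (a := fun (x : R) (n : nat) => p n x / INR (fact n)).
  assert (Ha : forall x, locally (0 : R) (fun t : R => is_pseries (a x) t (f x t))).
  { intros y; generalize (hp y); apply filter_imp; intros t Ht.
    apply is_pseries_R; revert Ht; apply is_series_ext; intros m.
    change (p m y * (t ^ m / INR (fact m)) = p m y / INR (fact m) * t ^ m).
    field; apply INR_fact_neq_0. }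
  (* Coefficients of x (1 + 2t) f_(x+1); [PS_incr_1] is multiplication by t. *)
  set (b := PS_scal x (PS_plus (a (x + 1)) (PS_scal 2 (PS_incr_1 (a (x + 1)))))).
  assert (Hb : locally (0 : R)
    (fun t : R => is_pseries b t (x * ((1 + 2 * t) * f (x + 1) t)))).
  { generalize (Ha (x + 1)); apply filter_imp; intros t Ht.
    replace (x * ((1 + 2 * t) * f (x + 1) t)) with
      (scal x (plus (f (x + 1) t) (scal 2 (scal t (f (x + 1) t)))) : R)
      by (unfold scal, plus; simpl; unfold mult; simpl; ring).
    apply (is_pseries_scal (K := R_AbsRing) (V := R_NormedModule));
      [apply Rmult_comm|].
    apply (is_pseries_plus (K := R_AbsRing) (V := R_NormedModule)); [exact Ht|].
    apply (is_pseries_scal (K := R_AbsRing) (V := R_NormedModule));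
      [apply Rmult_comm|].
    exact (is_pseries_incr_1 (K := R_AbsRing) (V := R_NormedModule) _ _ _ Ht). }
  assert (Ra := locally_pseries_CV_radius _ _ (Ha x)).
  (* Two power series with positive radius and equal sums near 0 have equal coefficients. *)
  assert (Heq : PS_derive (a x) n = b n).
  { apply PSeries_ext_recip.
    - rewrite CV_radius_derive; exact Ra.
    - exact (locally_pseries_CV_radius _ _ Hb).
    - assert (Hr : locally (0 : R) (fun t : R => Rbar_lt (Rabs t) (CV_radius (a x)))).
      { destruct (CV_radius (a x)) as [r | |]; simpl in Ra.
        - exists (mkposreal r Ra); intros t Ht.
          change (Rabs (t - 0) < r) in Ht; rewrite Rminus_0_r in Ht; exact Ht.
        - apply filter_forall; intros t; exact I.
        - contradiction. }
      assert (Hpos : locally (0 : R) (fun t : R => 0 < 1 - t - t ^ 2)).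
      { exists (mkposreal (1 / 2) ltac:(lra)); intros t Ht.
        change (Rabs (t - 0) < 1 / 2) in Ht; apply Rabs_def2 in Ht; nra. }
      (* Differentiating at t needs the series identity on a neighbourhood of t, hence
         [locally_locally]. *)
      generalize (filter_and _ _ (filter_and _ _ Hr Hpos)
        (filter_and _ _ Hb (locally_locally _ _ (Ha x)))).
      apply filter_imp; intros t [[Hrt Hpt] [Hbt Hat]].
      rewrite <- Derive_PSeries by exact Hrt.
      rewrite (is_pseries_unique _ _ _ Hbt).
      rewrite (Derive_ext_loc (PSeries (a x)) (f x)).
      + apply is_derive_unique, is_derive_fib_power, Hpt.
      + revert Hat; apply filter_imp; intros u; apply is_pseries_unique. }
  unfold b, PS_derive, PS_scal, PS_plus, a in Heq.
  unfold scal, plus in Heq; simpl in Heq; unfold mult in Heq; simpl in Heq.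
  assert (Hn : INR (fact n) <> 0) by apply INR_fact_neq_0.
  assert (Hl : p (S n) x / INR (fact n)
    = INR (S n) * (p (S n) x / INR (fact (S n)))).
  { rewrite fact_simpl, mult_INR; field.
    split; [exact Hn | apply not_0_INR; lia]. }
  apply (Rmult_eq_reg_r (/ INR (fact n))); [|apply Rinv_neq_0_compat, Hn].
  fold (Rdiv (p (S n) x) (INR (fact n))); rewrite Hl.
  etransitivity; [exact Heq|].
  (* For n = 0 the shifted series has coefficient 0, in agreement with the factor [INR 0] before
     [p (pred 0)]. *)
  destruct n as [|n]; simpl PS_incr_1.
  - unfold zero; simpl; field.
  - rewrite fact_simpl, mult_INR in *; simpl pred; field.
    split; [apply INR_fact_neq_0 | apply not_0_INR; lia].
Qed.

Theorem theorem7 (p : nat -> R -> R) (hp : convolved_fibonacci p)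
    (k N : nat) (x : R) :
  p (k + N)%nat x =
  sum_f_R0 (fun i : nat =>
    sum_f_R0 (fun l : nat =>
      Binomial.C k l * falling (INR N - 2 * INR i) l * 2 ^ l
        * coef_a i N * rising x (N - i)
        * p (k - l)%nat (x + INR (N - i))) k)
    ((N + 1) / 2).
Proof.
  rewrite (shift_expansion p (convolved_fibonacci_succ p hp) N x k).
  pose proof (Nat.div_mod_eq (N + 1) 2).
  pose proof (Nat.mod_upper_bound (N + 1) 2).
  (* Beyond [(N+1)/2] one has 2i > N, so a_i(N) = 0. *)
  rewrite (sum_f_R0_extend _ ((N + 1) / 2) N).
  - apply sum_eq; intros i _.
    unfold leibniz_sum; rewrite scal_sum.
    apply sum_eq; intros l _; ring.
  - lia.
  - intros i Hi; rewrite coef_a_eq_0 by lia; ring.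
Qed.
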